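(* Let $G$ be a finite $p$-group of nilpotence class two, for $p>2$ a prime. There is a one-to-one correspondence between (1) the regular subgroups $N$ of $S(G)$ with $N\trianglelefteq\operatorname{Hol}(G)$ such that, for the associated map $\gamma:G\to\operatorname{Aut}(G)$, (a) $\gamma(G)\le\operatorname{Aut}_c(G)$, and (b) $[Z(G),\gamma(G)]=1$; and (2) the bilinear maps $\Delta:G/Z(G)\times G/G'\to Z(G)$ such that $$\Delta(g^{\beta},h^{\beta})=\Delta(g,h)^{\beta}$$ for all $g\in G/Z(G)$, $h\in G/G'$ and $\beta\in\operatorname{Aut}(G)$. The correspondence is given by $$\Delta(gZ(G),hG')=[g,\gamma(h)]\qquad\text{for } g,h\in G.$$
   Context: $S(G)$ is the group of permutations of the set $G$, under left-to-right composition; permutations and automorphisms are written as exponents. $\rho:G\to S(G)$, $\rho(g):h\mapsto hg$, is the right regular representation and $\operatorname{Hol}(G)=N_{S(G)}(\rho(G))=\operatorname{Aut}(G)\rho(G)$. A subgroup $N\le S(G)$ is regular if for each $h\in G$ there is a unique $\nu(h)\in N$ with $1^{\nu(h)}=h$. If $N\trianglelefteq\operatorname{Hol}(G)$ is regular, then there is a unique map $\gamma:G\to\operatorname{Aut}(G)$, the map associated to $N$, such that $\nu(h)=\gamma(h)\rho(h)$ for all $h\in G$. $\operatorname{Aut}_c(G)=\{\alpha\in\operatorname{Aut}(G):[G,\alpha]\subseteq Z(G)\}$ is the group of central automorphisms. Commutators are taken in the abstract holomorph $\operatorname{Aut}(G)G$, with $[a,b]=a^{-1}b^{-1}ab$,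 so $[g,\alpha]=g^{-1}g^{\alpha}$ for $g\in G$, $\alpha\in\operatorname{Aut}(G)$. The groups $G/Z(G)$, $G/G'$, $Z(G)$ are abelian, and ''bilinear'' means additive in each argument; $\operatorname{Aut}(G)$ acts naturally on each of them. *)

(* Defs.v *)
From mathcomp Require Import all_boot all_fingroup all_solvable.

Set Implicit Arguments.
Unset Strict Implicit.
Unset Printing Implicit Defensive.

Import GroupScope.

(* The ambient finite group G is a whole finGroupType gT: S(G) is {perm gT},   *)
(* Aut(G) is Aut [set: gT], and G/H (H normal in G) is the type coset_of H.    *)
(* The product of {perm gT} is left-to-right composition: (s * t) x = t (s x). *)

Section Holomorph.

Variable gT : finGroupType.
Implicit Types (g h x : gT) (a b s : {perm gT}) (A : {set gT}).
Implicit Types (B : {set {perm gT}}) (N : {group {perm gT}}).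

Definition rho g : {perm gT} := actperm 'R g.

Lemma rhoE g x : rho g x = x * g.
Proof. by rewrite /rho actpermE. Qed.

Definition Hol : {group {perm gT}} := [group of 'N(rho @: [set: gT])].

Definition regular N : bool := [forall h, #|[set s in N | s 1 == h]| == 1%N].

Definition nu N h : {perm gT} := odflt 1 [pick s in N | s 1 == h].

Lemma nuP N h : regular N ->
  [/\ nu N h \in N, nu N h 1 = h & forall s, s \in N -> s 1 = h -> s = nu N h].
Proof.
move=> /forallP/(_ h)/cards1P[t Et].
have mem_t s : (s \in N) && (s 1 == h) = (s == t).
  by have /setP/(_ s) := Et; rewrite !inE.
rewrite /nu; case: pickP => [s | none] /=; last by have := mem_t t; rewrite none eqxx.
move=> /andP[Ns /eqP s1]; split=> // u Nu u1.
have /eqP -> : u == t by rewrite -mem_t Nu u1 eqxx.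
by apply/eqP; rewrite eq_sym -mem_t Ns s1 eqxx.
Qed.

Definition gamma N h : {perm gT} := nu N h * (rho h)^-1.

Lemma nuE N h : nu N h = gamma N h * rho h.
Proof. by rewrite /gamma mulgKV. Qed.

Lemma gamma_Aut N h : regular N -> N <| Hol -> gamma N h \in Aut [set: gT].
Proof.
move=> regN /andP[sNH _]; have [Nnu nu1 _] := nuP h regN.
have rhoM x y : rho x * rho y = rho (x * y).
  by apply/permP=> z; rewrite permM !rhoE mulgA.
have rhoK x y : (rho x)^-1 y = y * x^-1.
  by apply: (@perm_inj _ (rho x)); rewrite permKV rhoE mulgKV.
have Hrho x : rho x \in Hol.
  rewrite inE; apply/subsetP=> _ /imsetP[_ /imsetP[y _ ->] ->].
  apply/imsetP; exists (y ^ x); first by rewrite inE.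
  by apply/permP=> z; rewrite /conjg !permM rhoK !rhoE !mulgA.
have Hg : gamma N h \in Hol by rewrite /gamma groupM ?groupV // (subsetP sNH).
have g1 : gamma N h 1 = 1 by rewrite /gamma permM nu1 rhoK mulgV.
rewrite inE; apply/andP; split; first by apply/subsetP=> x; rewrite inE.
apply/morphicP=> x y _ _.
have: rho y ^ gamma N h \in rho @: [set: gT].
  by rewrite memJ_norm // imset_f.
case/imsetP=> z _ /(congr1 (fun s => gamma N h * s)).
rewrite -conjgC => E.
have Ez t : gamma N h (t * y) = gamma N h t * z.
  by have /permP/(_ t) := E; rewrite !permM !rhoE.
by rewrite Ez; have := Ez 1; rewrite mul1g g1 mul1g => ->.
Qed.

(* The commutator of g : G and an automorphism a in the abstract holomorph. *)
Definition autcomm g a : gT := g^-1 * a g.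

Definition autcommg A B : {group gT} :=
  <<[set autcomm g a | g in A, a in B]>>%G.

Definition Autc : {set {perm gT}} :=
  [set a in Aut [set: gT] | autcommg [set: gT] [set a] \subset 'Z([set: gT])].

Definition coset_aut (A : {group gT}) (x : coset_of A) b : coset_of A :=
  ([Aut [set: gT]] / A)%act x b.

Lemma coset_autE (A : {group gT}) g b : A \char [set: gT] -> b \in Aut [set: gT] ->
  coset_aut (coset A g) b = coset A (b g).
Proof.
move=> chA Ab; have nA x : x \in 'N(A).
  by rewrite (subsetP (char_norm chA)) ?inE.
rewrite /coset_aut /= qactE ?nA //.
rewrite (@qact_domE _ _ _ _ (aut_groupAction [set: gT])) ?(char_sub chA) //.
exact: (subsetP (acts_char (aut_groupAction [set: gT]) (subxx _) chA)).
Qed.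

Definition reg_class N : bool :=
  [&& regular N, N <| Hol,
      gamma N @: [set: gT] \subset Autc
    & autcommg 'Z([set: gT]) (gamma N @: [set: gT]) == 1%G].

Definition GmodZ := coset_of 'Z([set: gT]).
Definition Gab := coset_of [set: gT]^`(1).
Definition Zof := [subg 'Z([set: gT])]%type.

Definition bilinear (D : {ffun GmodZ * Gab -> Zof}) : bool :=
  [forall x, forall y, forall u, D (x * y, u) == D (x, u) * D (y, u)]
  && [forall x, forall u, forall v, D (x, u * v) == D (x, u) * D (x, v)].

Definition Aut_equivariant (D : {ffun GmodZ * Gab -> Zof}) : bool :=
  [forall b in Aut [set: gT], forall x, forall u,
     sgval (D (coset_aut x b, coset_aut u b)) == b (sgval (D (x, u)))].

Definition bilin_class D : bool := bilinear D && Aut_equivariant D.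

End Holomorph.

(* Main.v *)
Require Import Defs.
From mathcomp Require Import all_boot all_fingroup all_solvable.
Import GroupScope.

(** A regular subgroup N normal in Hol(G) is the set of all gamma(h) rho(h), so
    it amounts to a map gamma : G -> Aut(G).  Closure of N under products and
    under conjugation by rho(G) together say that gamma is an
    antihomomorphism ([gammaM]), and invariance of N under Aut(G) says that
    gamma commutes with the action of Aut(G) ([gamma_conj]).  When every
    gamma(h) is central and fixes Z(G), the commutator [g, gamma(h)] is central
    and additive in both g and h.  It then vanishes for g in Z(G), and for h in
    G' because its values commute; so it descends to the quotients.

    Conversely, a pairing d yields the maps g |-> g d(g, h), which are
    automorphisms because d is additive, central and trivial on Z(G).  They are
    multiplicative in h, so the products gamma(h) rho(h) form a group as soon
    as gamma(d(g, h)) = 1.  This is the one point that is not formal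
    ([pairing_value]): equivariance of d is applied to the automorphism
    gamma(h) itself, which fixes d(g, k) but moves k to k d(k, h).

    The dictionary with bilinear maps on G/Z(G) x G/G' goes through functions of
    two variables on G ([pairing]); N is recovered from its commutators since
    these determine gamma, hence nu, hence N. *)

Section Correspondence.

Set Implicit Arguments.
Unset Strict Implicit.
Unset Printing Implicit Defensive.

Variable gT : finGroupType.
Local Notation G := [set: gT].
Local Notation Z := 'Z([set: gT]).
Implicit Types (g h k x y z : gT) (a b s : {perm gT}).
Implicit Types (N : {group {perm gT}}) (D : {ffun GmodZ gT * Gab gT -> Zof gT}).

(** * The holomorph *)

Lemma centerT_comm z x : z \in Z -> z * x = x * z.
Proof. by case/centerP=> _ /(_ x (in_setT x)). Qed.

Lemma AutTM a : a \in Aut G -> {morph a : x y / x * y}.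
Proof. by case/setIdP=> _ /morphicP aM x y; rewrite aM ?inE. Qed.

Lemma AutT1 a : a \in Aut G -> a 1 = 1.
Proof. by move/AutTM=> aM; apply: (mulgI (a 1)); rewrite -aM !mulg1. Qed.

Lemma AutTV a : a \in Aut G -> {morph a : x / x^-1}.
Proof.
by move=> Aa x; apply: (mulgI (a x)); rewrite -AutTM // !mulgV AutT1.
Qed.

Lemma AutTI a : {morph a : x y / x * y} -> a \in Aut G.
Proof.
move=> aM; rewrite inE; apply/andP; split; first by apply/subsetP=> x; rewrite inE.
by apply/morphicP=> x y _ _; apply: aM.
Qed.

Lemma rhoM x y : rho (x * y) = rho x * rho y.
Proof. by apply/permP=> z; rewrite permM !rhoE mulgA. Qed.

Lemma rhoVE x y : (rho x)^-1 y = y * x^-1.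
Proof. by apply: (@perm_inj _ (rho x)); rewrite permKV rhoE mulgKV. Qed.

Lemma rho_conj a x : a \in Aut G -> rho x ^ a = rho (a x).
Proof.
move=> Aa; apply/permP=> z.
by rewrite /conjg !permM !rhoE AutTM // permKV.
Qed.

Lemma holM a b x y : b \in Aut G ->
  (a * rho x) * (b * rho y) = a * b * rho (b x * y).
Proof. by move=> Ab; rewrite rhoM -(rho_conj x Ab) /conjg !mulgA mulgK. Qed.

Lemma holJ_rho a x g : a \in Aut G ->
  (a * rho x) ^ rho g = a * rho ((a g)^-1 * x * g).
Proof.
move=> Aa; apply/permP=> y.
by rewrite /conjg !permM rhoVE !rhoE AutTM // AutTV // !mulgA.
Qed.

Lemma rho_Hol x : rho x \in Hol gT.
Proof.
rewrite inE; apply/subsetP=> _ /imsetP[_ /imsetP[y _ ->] ->].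
apply/imsetP; exists (y ^ x); first by rewrite inE.
rewrite /conjg !rhoM; congr (_ * _).
by apply/permP=> z; rewrite rhoVE rhoE.
Qed.

Lemma Aut_Hol a : a \in Aut G -> a \in Hol gT.
Proof.
move=> Aa; rewrite inE; apply/subsetP=> _ /imsetP[_ /imsetP[y _ ->] ->].
by rewrite rho_conj // imset_f ?inE.
Qed.

(** The stabiliser of 1 in the normaliser of rho(G) is Aut(G): an element s of
    it sends rho(y) to some rho(z), and comparing values at 1 gives z = s(y). *)
Lemma Hol_stab1 s : s \in Hol gT -> s 1 = 1 -> s \in Aut G.
Proof.
move=> Hs s1; apply: AutTI => x y.
have /imsetP[z _ Ez]: rho y ^ s \in @rho gT @: G by rewrite memJ_norm // imset_f.
have sM t : s (t * y) = s t * z.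
  by have /permP/(_ (s t)) := Ez; rewrite /conjg !permM permK !rhoE.
by rewrite sM -[y in RHS]mul1g sM s1 mul1g.
Qed.

Lemma Hol_decomp s : s \in Hol gT -> s * (rho (s 1))^-1 \in Aut G.
Proof.
move=> Hs; apply: Hol_stab1; first by rewrite groupM ?groupV ?rho_Hol.
by rewrite permM rhoVE mulgV.
Qed.

(** * The map associated to a normal regular subgroup *)

Lemma nu1E N h : regular N -> nu N h 1 = h.
Proof. by move=> regN; case: (nuP h regN). Qed.

Lemma nu_mem N h : regular N -> nu N h \in N.
Proof. by move=> regN; case: (nuP h regN). Qed.

Lemma nu_val N s : regular N -> s \in N -> s = nu N (s 1).
Proof. by move=> regN Ns; case: (nuP (s 1) regN) => _ _; apply. Qed.

Lemma nu_eqP N1 N2 : regular N1 -> regular N2 -> nu N1 =1 nu N2 -> N1 = N2.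
Proof.
move=> reg1 reg2 eq_nu; apply/val_inj/setP=> s /=.
apply/idP/idP=> Ns; first by rewrite (nu_val reg1 Ns) eq_nu nu_mem.
by rewrite (nu_val reg2 Ns) -eq_nu nu_mem.
Qed.

Section NormalRegular.

Variable N : {group {perm gT}}.
Hypotheses (regN : regular N) (nN : N <| Hol gT).

Lemma gammaA h : gamma N h \in Aut G.
Proof. exact: gamma_Aut. Qed.

Lemma nuJ s h : s \in Hol gT -> nu N h ^ s = nu N ((nu N h ^ s) 1).
Proof.
move=> Hs; apply: nu_val => //; rewrite memJ_norm ?nu_mem //.
by case/andP: nN => _ /subsetP; apply.
Qed.

(** Closure of N under products, read off at the point 1. *)
Lemma gamma_circ g h : gamma N (gamma N h g * h) = gamma N g * gamma N h.
Proof.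
have E: nu N g * nu N h = nu N (gamma N h g * h).
  rewrite [LHS](nu_val regN) ?groupM ?nu_mem // permM nu1E //.
  by rewrite [nu N h]nuE permM rhoE.
apply: (mulIg (rho (gamma N h g * h))); by rewrite -nuE -E !nuE holM ?gammaA.
Qed.

(** Invariance of N under conjugation by automorphisms. *)
Lemma gamma_conj b h : b \in Aut G -> gamma N (b h) = gamma N h ^ b.
Proof.
move=> Ab; have E := nuJ h (Aut_Hol Ab).
have Eb : (nu N h ^ b) 1 = b h.
  by rewrite /conjg !permM -[in b^-1 1](AutT1 Ab) permK nu1E.
apply: (mulIg (rho (b h))).
by rewrite -nuE -Eb -E Eb nuE conjMg rho_conj.
Qed.

(** Invariance of N under conjugation by right translations. *)
Lemma gamma_transl g h : gamma N ((gamma N h g)^-1 * h * g) = gamma N h.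
Proof.
have E := nuJ h (rho_Hol g).
have Eh := holJ_rho h g (gammaA h); rewrite -nuE in Eh.
have E1 : (nu N h ^ rho g) 1 = (gamma N h g)^-1 * h * g.
  by rewrite Eh permM rhoE AutT1 ?gammaA // mul1g.
apply: (mulIg (rho ((gamma N h g)^-1 * h * g))).
by rewrite -nuE -[in LHS]E1 -E Eh.
Qed.

(** Any product k * y can be written y^gamma(h) * h with gamma(h) = gamma(k), by
    translation invariance; closure under products then applies. *)
Lemma gammaM k y : gamma N (k * y) = gamma N y * gamma N k.
Proof.
have Eh := gamma_transl y k; set h := (_ * y) in Eh.
have <-: gamma N h y * h = k * y by rewrite Eh /h -[_^-1 * k * y]mulgA mulKVg.
by rewrite gamma_circ Eh.
Qed.

End NormalRegular.

Lemma reg_classP N :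
  reflect [/\ regular N, N <| Hol gT, forall g h, autcomm g (gamma N h) \in Z
             & forall z h, z \in Z -> gamma N h z = z]
          (reg_class N).
Proof.
apply: (iffP and4P) => [[regN nN /subsetP cN /eqP/(congr1 val)/= zN] | [regN nN cN zN]].
  split=> // [g h | z h Zz].
    have /setIdP[_ /subsetP] := cN _ (imset_f (gamma N) (in_setT h)).
    by apply; apply: mem_gen; apply: imset2_f; rewrite !inE.
  have: autcomm z (gamma N h) \in [1 gT].
    by rewrite -zN; apply: mem_gen; apply: imset2_f; rewrite ?imset_f ?in_setT.
  by move/set1P=> E; apply: (mulgI z^-1); rewrite mulVg.
split=> //.
  apply/subsetP=> _ /imsetP[h _ ->]; rewrite inE gamma_Aut //= gen_subG.
  by apply/subsetP=> _ /imset2P[g _ _ /set1P-> ->].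
rewrite -val_eqE /= -subG1 gen_subG.
apply/subsetP=> _ /imset2P[z _ Zz /imsetP[h _ ->] ->].
by rewrite /autcomm zN // mulVg inE.
Qed.

(** * Pairings on G *)

(** The pullbacks to G x G of the equivariant bilinear maps on
    G/Z(G) x G/G'; triviality on G' is automatic ([pairing_der]). *)
Definition pairing (d : gT -> gT -> gT) : Prop :=
  [/\ forall g h, d g h \in Z,
      forall h, {morph d^~ h : x y / x * y},
      forall g, {morph d g : x y / x * y},
      forall z h, z \in Z -> d z h = 1
    & forall b g h, b \in Aut G -> d (b g) (b h) = b (d g h)].

Section Pairing.

Variable d : gT -> gT -> gT.
Hypothesis dP : pairing d.

Let dZ : forall g h, d g h \in Z. Proof. by case: dP. Qed.
Let dMl : forall h, {morph d^~ h : x y / x * y}. Proof. by case: dP. Qed.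
Let dMr : forall g, {morph d g : x y / x * y}. Proof. by case: dP. Qed.
Let d1 : forall z h, z \in Z -> d z h = 1. Proof. by case: dP. Qed.
Let dA : forall b g h, b \in Aut G -> d (b g) (b h) = b (d g h).
Proof. by case: dP. Qed.

Lemma pairing_r1 g : d g 1 = 1.
Proof. by apply: (mulgI (d g 1)); rewrite -dMr !mulg1. Qed.

(** The values of d(g, .) commute, so the preimage of 1 is a subgroup that
    contains all commutators. *)
Lemma pairing_der g u : u \in G^`(1) -> d g u = 1.
Proof.
pose K := [set v | d g v == 1].
have gK : group_set K.
  apply/group_setP; split=> [|x y]; rewrite !inE ?pairing_r1 //.
  by move=> /eqP Ex /eqP Ey; rewrite dMr Ex Ey mulg1.
suff /subsetP sK : G^`(1) \subset Group gK by move/sK; rewrite inE => /eqP.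
rewrite gen_subG; apply/subsetP=> _ /imset2P[x y _ _ ->]; rewrite inE.
apply/eqP/(mulgI (d g (y * x))).
by rewrite -dMr mulg1 -commgC !dMr centerT_comm.
Qed.

(** If x d(x, h) = y d(y, h) then x and y differ by an element of the centre,
    on which d(., h) is trivial; hence d(x, h) = d(y, h). *)
Lemma pairing_act_inj h : injective (fun g => g * d g h).
Proof.
move=> x y /= E; have Ez: x * y^-1 \in Z.
  have ->: x * y^-1 = d y h * (d x h)^-1.
    apply: (mulIg y); apply: (mulIg (d x h)); rewrite mulgKV E.
    by rewrite -!mulgA -(centerT_comm y (dZ x h)) mulKg (centerT_comm y (dZ y h)).
  by rewrite groupM ?groupV.
have Exy : d x h = d y h by rewrite -[x](mulgKV y) dMl d1 // mul1g.
by apply: (mulIg (d y h)); rewrite -E Exy.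
Qed.

Definition pairing_act h : {perm gT} := perm (@pairing_act_inj h).

Lemma pairing_actE h g : pairing_act h g = g * d g h.
Proof. by rewrite permE. Qed.

Lemma pairing_act_Aut h : pairing_act h \in Aut G.
Proof.
apply: AutTI => x y; rewrite !pairing_actE dMl -!mulgA; congr (_ * _).
by rewrite !mulgA (centerT_comm y (dZ x h)).
Qed.

Lemma pairing_act_fix h z : z \in Z -> pairing_act h z = z.
Proof. by move=> Zz; rewrite pairing_actE d1 // mulg1. Qed.

(** Let b be the automorphism x |-> x d(x, h).  Then
    d(g, k) = b(d(g, k)) = d(b(g), b(k)) = d(g, k d(k, h)), the outer equalities
    holding because b fixes Z(G) pointwise and d is trivial on it. *)
Lemma pairing_value g k h : d g (d k h) = 1.
Proof.
apply: (mulgI (d g k)); rewrite mulg1 -dMr.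
have := dA g k (pairing_act_Aut h).
by rewrite (pairing_act_fix h (dZ g k)) !pairing_actE dMl [d (d g h) _]d1 // mulg1.
Qed.

Lemma pairing_actM h k : pairing_act (h * k) = pairing_act h * pairing_act k.
Proof.
apply/permP=> g; rewrite permM !pairing_actE dMr dMl.
by rewrite [d (d g h) k]d1 // mulg1 mulgA.
Qed.

Lemma pairing_act_eq1 u : (forall g, d g u = 1) -> pairing_act u = 1.
Proof. by move=> du; apply/permP=> g; rewrite pairing_actE du mulg1 perm1. Qed.

Lemma pairing_act_conj b h : b \in Aut G ->
  pairing_act h ^ b = pairing_act (b h).
Proof.
move=> Ab; apply/permP=> x; rewrite /conjg !permM !pairing_actE AutTM //.
by rewrite -dA // permKV.
Qed.

Definition pairing_nu h : {perm gT} := pairing_act h * rho h.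

Lemma pairing_nu1 h : pairing_nu h 1 = h.
Proof. by rewrite permM rhoE AutT1 ?pairing_act_Aut // mul1g. Qed.

Lemma pairing_nuM g h : pairing_nu g * pairing_nu h = pairing_nu (g * d g h * h).
Proof.
rewrite /pairing_nu holM ?pairing_act_Aut // pairing_actE !pairing_actM.
rewrite (pairing_act_eq1 (u := d g h)) ?mulg1 // => k.
exact: pairing_value.
Qed.

Lemma pairing_group_set : group_set [set pairing_nu h | h in G].
Proof.
apply/group_setP; split=> [|_ _ /imsetP[g _ ->] /imsetP[h _ ->]]; last first.
  by rewrite pairing_nuM imset_f ?inE.
apply/imsetP; exists 1; rewrite ?inE // /pairing_nu pairing_act_eq1 ?mul1g.
  by apply/permP=> x; rewrite rhoE mulg1 perm1.
exact: pairing_r1.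
Qed.

Definition pairing_group : {group {perm gT}} := Group pairing_group_set.

Lemma mem_pairing_group h : pairing_nu h \in pairing_group.
Proof. by rewrite imset_f ?inE. Qed.

Lemma pairing_group_regular : regular pairing_group.
Proof.
apply/forallP=> h; apply/cards1P; exists (pairing_nu h); apply/setP=> s.
rewrite !inE; apply/andP/eqP=> [[/imsetP[k _ ->]] | ->]; last first.
  by rewrite mem_pairing_group pairing_nu1.
by rewrite pairing_nu1 => /eqP->.
Qed.

Lemma nu_pairing_group h : nu pairing_group h = pairing_nu h.
Proof.
rewrite -[h in LHS]pairing_nu1 -(nu_val pairing_group_regular) //.
exact: mem_pairing_group.
Qed.

Lemma gamma_pairing_group h : gamma pairing_group h = pairing_act h.
Proof. by rewrite /gamma nu_pairing_group mulgK. Qed.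

(** Translating pairing_nu h by g replaces h, inside pairing_act, by its product
    with a commutator and a value of d, both of which act trivially. *)
Lemma pairing_nuJ_rho h g : pairing_nu h ^ rho g \in pairing_group.
Proof.
pose k := (g * d g h)^-1 * h * g.
suff ->: pairing_nu h ^ rho g = pairing_nu k by apply: mem_pairing_group.
have Ek : k = h * [~ h, g] * (d g h)^-1.
  by rewrite /k invMg commgEl mulKVg -(centerT_comm _ (groupVr (dZ g h))) !mulgA.
have Eact : pairing_act k = pairing_act h.
  rewrite Ek pairing_actM (pairing_actM h) (pairing_act_eq1 (u := [~ h, g])) ?mulg1; last first.
    by move=> x; rewrite pairing_der // mem_commg ?inE.
  rewrite (pairing_act_eq1 (u := (d g h)^-1)) ?mulg1 // => x.
  apply: (mulgI (d x (d g h))).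
  by rewrite -dMr mulgV pairing_r1 pairing_value mulg1.
by rewrite /pairing_nu Eact holJ_rho ?pairing_act_Aut // pairing_actE.
Qed.

Lemma pairing_group_normal : pairing_group <| Hol gT.
Proof.
apply/andP; split; last first.
  apply/subsetP=> s Hs; rewrite inE; apply/subsetP=> _ /imsetP[_ /imsetP[h _ ->] ->].
  rewrite -[s](mulgKV (rho (s 1))) conjgM.
  have := Hol_decomp Hs; set a := (s * _) => Aa.
  have -> : pairing_nu h ^ a = pairing_nu (a h).
    by rewrite /pairing_nu conjMg rho_conj // pairing_act_conj.
  exact: pairing_nuJ_rho.
apply/subsetP=> _ /imsetP[h _ ->].
by rewrite groupM ?rho_Hol ?Aut_Hol ?pairing_act_Aut.
Qed.

Lemma autcomm_pairing_group g h : autcomm g (gamma pairing_group h) = d g h.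
Proof. by rewrite /autcomm gamma_pairing_group pairing_actE mulKg. Qed.

Lemma pairing_group_class : reg_class pairing_group.
Proof.
apply/reg_classP; split=> [| | g h | z h Zz].
- exact: pairing_group_regular.
- exact: pairing_group_normal.
- by rewrite autcomm_pairing_group.
- by rewrite gamma_pairing_group pairing_act_fix.
Qed.

End Pairing.

(** Additivity on the left uses that commutators with gamma(h) are central;
    on the right, that gamma(x) fixes the central element [g, gamma(y)]. *)
Lemma gamma_pairing N : reg_class N -> pairing (fun g h => autcomm g (gamma N h)).
Proof.
case/reg_classP=> regN nN cN zN.
have gA := gammaA regN nN.
split=> // [h x y | g x y | z h Zz | b g h Ab]; rewrite /autcomm.
- rewrite AutTM // invMg [RHS]mulgA (centerT_comm y^-1 (cN x h)).
  by rewrite /autcomm !mulgA.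
- rewrite gammaM // permM -[gamma N y g in LHS](mulKVg g) AutTM //.
  by rewrite (zN _ _ (cN g y)) mulgA.
- by rewrite zN // mulVg.
- by rewrite gamma_conj // /conjg !permM permK AutTM // AutTV.
Qed.

(** * Descent to the quotients *)

Lemma normT (A : {group gT}) x : A \char G -> x \in 'N(A).
Proof. by move/char_norm/subsetP; apply; rewrite inE. Qed.

Lemma cosetTM (A : {group gT}) : A \char G -> {morph coset A : x y / x * y}.
Proof. by move=> chA x y; rewrite morphM ?normT. Qed.

Lemma repr_cosetT (A : {group gT}) x : A \char G ->
  exists2 a, a \in A & repr (coset A x) = a * x.
Proof.
move=> chA; apply/rcosetP/rcoset_kercosetP; rewrite ?normT //.
exact: coset_reprK.
Qed.

Definition lift D g h : gT := sgval (D (coset Z g, coset G^`(1) h)).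

Definition descend (d : gT -> gT -> gT) : {ffun GmodZ gT * Gab gT -> Zof gT} :=
  [ffun xu : GmodZ gT * Gab gT => subg 'Z([set: gT]) (d (repr xu.1) (repr xu.2))].

Lemma descendE d g h : pairing d -> lift (descend d) g h = d g h.
Proof.
move=> dP; have [dZ dMl dMr d1 _] := dP.
rewrite /lift ffunE /= subgK //.
have [z Zz ->] := repr_cosetT g (center_char G).
have [u Gu ->] := repr_cosetT h (der_char 1 G).
by rewrite dMl d1 // mul1g dMr (pairing_der dP) // mul1g.
Qed.

Lemma liftK D : descend (lift D) = D.
Proof.
apply/ffunP=> -[x u]; rewrite ffunE /lift !coset_reprK; exact: sgvalK.
Qed.

Lemma lift_inj D1 D2 : lift D1 =2 lift D2 -> D1 = D2.
Proof.
move=> E; rewrite -[D1]liftK -[D2]liftK.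
by apply/ffunP=> xu; rewrite !ffunE E.
Qed.

Lemma bilin_classP D : reflect (pairing (lift D)) (bilin_class D).
Proof.
have chZ := center_char G; have chD := der_char 1 G.
apply: (iffP andP) => [[/andP[/forallP DMl /forallP DMr] /forall_inP DA] | dP].
  have liftMl h : {morph lift D ^~ h : x y / x * y}.
    move=> x y; rewrite /lift cosetTM //.
    by have /forallP/(_ (coset Z y))/forallP/(_ (coset G^`(1) h))/eqP -> := DMl (coset Z x).
  split=> // [g h | g x y | z h Zz | b g h Ab]; rewrite ?/lift.
  - exact: subgP.
  - rewrite cosetTM //.
    by have /forallP/(_ (coset G^`(1) x))/forallP/(_ (coset G^`(1) y))/eqP -> := DMr (coset Z g).
  - have E : lift D z h = lift D 1 h by rewrite /lift (coset_id Zz) morph1.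
    rewrite -/(lift D z h) E; apply: (mulgI (lift D 1 h)).
    by rewrite -[LHS]liftMl !mulg1.
  - rewrite -!coset_autE //.
    by have /forallP/(_ (coset Z g))/forallP/(_ (coset G^`(1) h))/eqP := DA b Ab.
have [dZ dMl dMr _ dA] := dP; split; [apply/andP; split|].
- apply/forallP=> x; apply/forallP=> y; apply/forallP=> u; apply/eqP/val_inj.
  have := dMl (repr u) (repr x) (repr y).
  by rewrite /lift /= cosetTM // !coset_reprK.
- apply/forallP=> x; apply/forallP=> u; apply/forallP=> v; apply/eqP/val_inj.
  have := dMr (repr x) (repr u) (repr v).
  by rewrite /lift /= cosetTM // !coset_reprK.
- apply/forall_inP=> b Ab; apply/forallP=> x; apply/forallP=> u; apply/eqP.
  have := dA b (repr x) (repr u) Ab.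
  by rewrite /lift -!coset_autE // !coset_reprK.
Qed.

Lemma descend_class d : pairing d -> bilin_class (descend d).
Proof.
move=> dP; have [dZ dMl dMr d1 dA] := dP; apply/bilin_classP.
split=> [g h | h x y | g x y | z h Zz | b g h Ab]; rewrite !(descendE _ _ dP).
- exact: dZ.
- exact: dMl.
- exact: dMr.
- exact: d1.
- exact: dA.
Qed.

End Correspondence.

Theorem proposition2p2 (gT : finGroupType) (p : nat)
    (p_prime : prime p) (p_gt2 : 2 < p)
    (pG : p.-group [set: gT]) (clG : nil_class [set: gT] = 2) :
  exists Phi : {N : {group {perm gT}} | reg_class N} ->
               {D : {ffun GmodZ gT * Gab gT -> Zof gT} | bilin_class D},
    bijective Phi /\
    forall N (g h : gT),
      sgval (val (Phi N) (coset 'Z([set: gT]) g, coset [set: gT]^`(1) h))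
      = autcomm g (gamma (val N) h).
Proof.
pose comm_of N g h := autcomm g (gamma N h) : gT.
have descendP N : reg_class N -> bilin_class (descend (comm_of N)).
  by move/gamma_pairing; apply: descend_class.
pose Phi (N : {N | reg_class N}) :
    {D : {ffun GmodZ gT * Gab gT -> Zof gT} | bilin_class D} :=
  exist (@bilin_class gT) _ (descendP _ (valP N)).
pose Psi (D : {D : {ffun GmodZ gT * Gab gT -> Zof gT} | bilin_class D}) :
    {N | reg_class N} :=
  exist (@reg_class gT) _ (pairing_group_class (elimT (bilin_classP _) (valP D))).
have PhiE N g h : lift (val (Phi N)) g h = autcomm g (gamma (val N) h).
  exact: descendE (gamma_pairing (valP N)).
have PsiK : cancel Psi Phi.
  by move=> D; apply/val_inj/lift_inj=> g h; rewrite PhiE autcomm_pairing_group.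
have Phi_inj : injective Phi.
  move=> N1 N2 E; apply: val_inj; have [reg1 _ _ _] := reg_classP _ (valP N1).
  have [reg2 _ _ _] := reg_classP _ (valP N2).
  apply: nu_eqP => // h; rewrite !nuE; congr (_ * _); apply/permP=> g.
  by apply: (mulgI g^-1); have := PhiE N1 g h; rewrite E PhiE.
by exists Phi; split=> //; exists Psi => //; apply: inj_can_sym PsiK Phi_inj.
Qed.
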